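(* For each integer $\ell\ge 3$ there exists a constant $L(\ell)\ge 0$ for which $$|\mathcal D_{\triangleright,\ell}(n)| = e^{nL(\ell)+o(n)}\quad\text{as } n\to\infty.$$
   Context: For a positive integer $N$, $[N]=\{1,\dots,N\}$. A die with $n$ faces is a vector $D=(D_1,\dots,D_n)$ of real numbers; dice are fair (each face is rolled with probability $1/n$). A die $A$ is better than a die $B$, written $A\triangleright B$, if $\#\{(i,j): A_i>B_j\} > \#\{(i,j): B_j>A_i\}$. $\mathcal D_\ell(n)$ is the set of ordered collections $\mathbf D=(D^{(1)},\dots,D^{(\ell)})$ of $\ell$ dice, each die $D^{(j)}=(D^{(j)}_1,\dots,D^{(j)}_n)$ having $n$ integer faces listed in increasing order $0<D^{(j)}_1<\cdots<D^{(j)}_n$, such that each number in $[\ell n]$ appears exactly once among all the faces of all the dice. $\mathcal D_{\triangleright,\ell}(n)$ is the subset of those $\mathbf D\in\mathcal D_\ell(n)$ with $D^{(1)}\triangleright D^{(2)}\triangleright\cdots\triangleright D^{(\ell)}\triangleright D^{(1)}$ (intransitive collections). *)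

(* Defs.v *)
(* MathComp, with MathComp-Analysis for the asymptotics *)
From mathcomp Require Import all_boot all_order all_algebra.
From mathcomp Require Import all_classical all_reals all_analysis.

Set Implicit Arguments.
Unset Strict Implicit.
Unset Printing Implicit Defensive.

(* Faces may lie in any totally ordered type: T := R gives dice with real
   faces. *)
Definition die {d : Order.disp_t} (T : orderType d) (n : nat) : Type :=
  {ffun 'I_n -> T}.

Definition better {d : Order.disp_t} {T : orderType d} {n : nat}
    (A B : die T n) : bool :=
  #|[set p : 'I_n * 'I_n | (A p.1 > B p.2)%O]|
    > #|[set p : 'I_n * 'I_n | (B p.2 > A p.1)%O]|.

(* The type bounds the faces by l * n; this is no restriction on the
   collections counted below, in which the l * n faces take each of the values
   1, ..., l * n exactly once. *)
Definition collection (l n : nat) : finType :=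
  {ffun 'I_l -> {ffun 'I_n -> 'I_(l * n).+1}}.

Definition is_dice_collection (l n : nat) (D : collection l n) : bool :=
  [&& [forall j : 'I_l, forall i : 'I_n, 0 < D j i],
      [forall j : 'I_l, forall i : 'I_n, forall i' : 'I_n,
         (i < i') ==> (D j i < D j i')]
    & [forall k : 'I_(l * n).+1, (0 < k) ==>
         (#|[set p : 'I_l * 'I_n | D p.1 p.2 == k]| == 1)]].

Definition dice_collections (l n : nat) : {set collection l n} :=
  [set D | is_dice_collection D].

(* ordS is the cyclic successor on 'I_l, so the last die is compared with the
   first. *)
Definition intransitive_collections (l n : nat) : {set collection l n} :=
  [set D in dice_collections l n | [forall j : 'I_l, better (D j) (D (ordS j))]].

(* Main.v *)
(** Stacking one collection on top of another multiplies counts, because the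
    comparisons between a lower and an upper face of two dice occur equally
    often in both directions.  Hence the logarithm of the number of intransitive
    collections is superadditive, and Fekete's lemma applies once this number is
    known to be eventually positive and at most exponential.  Positivity comes
    from Condorcet cycles: cut [l * n] into [n] blocks of length [l], and let the
    dice take one face in each block, in an order that is rotated by one from
    each block to the next. *)
Require Import Defs.
From mathcomp Require Import all_boot all_order all_algebra.
From mathcomp Require Import all_classical all_reals all_analysis.
From mathcomp Require Import zify ring lra.
Import Order.TTheory GRing.Theory Num.Theory.
Import numFieldNormedType.Exports.

Local Open Scope classical_set_scope.
Local Open Scope ring_scope.

(** * Fekete's lemma for sequences superadditive from [N] on *)

Section Fekete.
Variables (R : realType) (u : nat -> R) (N : nat) (C : R).
Hypotheses (N_gt0 : (0 < N)%N) (u_ge0 : forall n, (N <= n)%N -> 0 <= u n).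
Hypothesis superadd :
  forall m n, (N <= m)%N -> (N <= n)%N -> u m + u n <= u (m + n)%N.
Hypothesis u_le : forall n, (N <= n)%N -> u n <= n%:R * C.

(** Superadditivity is available only from [N] on; carrying the summand [s] keeps every partial sum
    in that range, including the case [q = 0]. *)
Lemma superadd_mulrn m s q :
  (N <= m)%N -> (N <= s)%N -> q%:R * u m <= u (q * m + s)%N.
Proof.
move=> Nm Ns; elim: q => [|q IHq]; first by rewrite mul0r u_ge0.
rewrite mulSn -addnA; have Nqs : (N <= q * m + s)%N.
  by apply: leq_trans Ns _; rewrite leq_addl.
apply: (le_trans _ (superadd _ _ Nm Nqs)).
by rewrite -natr1 mulrDl mul1r addrC lerD2l.
Qed.

Lemma fekete_lower m n : (N <= m)%N -> (N <= n)%N ->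
  (n%:R - (N + m)%:R) * (u m / m%:R) <= u n.
Proof.
move=> Nm Nn; have m_gt0 : (0 < m)%N by lia.
have m0 : 0 < m%:R :> R by rewrite ltr0n.
(* Dividing [n - N] rather than [n] makes the remainder [s] at least [N], so superadditivity
   applies, and at most [N + m], which bounds the loss. *)
pose q := ((n - N) %/ m)%N; pose s := (N + (n - N) %% m)%N.
have nE : n = (q * m + s)%N.
  by rewrite /q /s addnCA -divn_eq; lia.
have sN : (N <= s)%N by rewrite leq_addr.
have sm : (s <= N + m)%N by rewrite leq_add2l ltnW // ltn_pmod.
apply: le_trans (_ : q%:R * u m <= _); last first.
  by rewrite nE; exact: superadd_mulrn.
have -> : q%:R * u m = (q * m)%:R * (u m / m%:R).
  by rewrite natrM; field; rewrite gt_eqF.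
rewrite ler_wpM2r ?divr_ge0 ?u_ge0 // lerBlDr -natrD ler_nat nE; lia.
Qed.

Lemma fekete : exists L : R,
  0 <= L /\ (fun n => u n - n%:R * L) =o_\oo (fun n : nat => n%:R : R).
Proof.
(* The limit is the supremum of these ratios, so the upper estimate [u n <= n * sup S] is
   immediate. *)
pose S := [set u m / m%:R | m in [set m | (N <= m)%N]].
have gt0 m : (N <= m)%N -> 0 < m%:R :> R by move=> Nm; rewrite ltr0n; lia.
have SN : S (u N / N%:R) by exists N => /=.
have S_ub : ubound S C.
  by move=> _ [m /= Nm <-]; rewrite ler_pdivrMr ?gt0 // mulrC u_le.
have supS : has_sup S by split; [exists (u N / N%:R) | exists C].
have S_le m : (N <= m)%N -> u m / m%:R <= sup S.
  by move=> Nm; apply: ub_le_sup; [exact: supS.2 | exists m].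
have L_ge0 : 0 <= sup S.
  by apply: le_trans (S_le _ (leqnn N)); rewrite divr_ge0 ?u_ge0.
exists (sup S); split=> //; apply/eqoP => e e0.
(* One [m] is fixed with ratio within [e / 2] of the supremum. The other [e / 2] pays for the loss
   [(N + m) * v] in [fekete_lower], which does not depend on [n]. *)
have [_ [m /= Nm <-] hm] := sup_adherent (divr_gt0 e0 (ltr0n R 2)) supS.
set v := u m / m%:R in hm.
near=> n.
have Nn : (N <= n)%N by near: n; exists N.
have n0 := gt0 _ Nn.
have up : u n <= n%:R * sup S.
  by rewrite -ler_pdivrMl // mulrC S_le.
have lo := fekete_lower _ _ Nm Nn; rewrite -/v in lo.
have big : (N + m)%:R * v <= n%:R * (e / 2).
  rewrite -ler_pdivrMr ?divr_gt0 //.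
  by near: n; exact: nbhs_infty_ger.
rewrite normr_nat ler0_norm ?subr_le0 // opprB.
have : n%:R * (sup S - e / 2) <= n%:R * v by rewrite ler_wpM2l // ltW.
lra.
Unshelve. all: by end_near. Qed.

End Fekete.

Local Open Scope nat_scope.

(** * Comparisons as sums, collections as injections *)

Lemma card_rel n (P : 'I_n -> 'I_n -> bool) :
  #|[set p : 'I_n * 'I_n | P p.1 p.2]%SET| = \sum_i \sum_j P i j.
Proof.
rewrite -sum1_card pair_big /= [LHS]big_mkcond; apply: eq_bigr => p _.
by rewrite inE; case: (P _ _).
Qed.

(** Double sums of booleans can be split along index ranges, as the stacking and rotation arguments
    require. *)
Lemma betterE n N (A B : die 'I_N n) :
  better A B = (\sum_i \sum_j (A i < B j) < \sum_i \sum_j (B j < A i)).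
Proof.
by rewrite -(card_rel _ (fun i j => A i < B j))
  -(card_rel _ (fun i j => B j < A i)).
Qed.

Section Collections.
Variable l : nat.

(** Pigeonhole: there are [l * n] positions and [l * n] nonzero values, so an injective positive
    labelling attains each value exactly once. *)
Lemma dice_collectionP n (D : collection l n) :
  reflect [/\ forall j i, 0 < D j i,
              forall j (i i' : 'I_n), i < i' -> D j i < D j i'
            & injective (fun p : 'I_l * 'I_n => D p.1 p.2)]
          (is_dice_collection D).
Proof.
apply: (iffP and3P) => [[D0 Dlt D1]|[D0 Dlt Dinj]].
  have pos j i : 0 < D j i by move/forallP/(_ j)/forallP: D0.
  split=> // [j i i'|p q /= Dpq].
    by move/forallP/(_ j)/forallP/(_ i)/forallP/(_ i')/implyP: Dlt.
  move/forallP/(_ (D p.1 p.2))/implyP/(_ (pos _ _))/cards1P: D1 => [x xE].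
  have : p \in [set x]%SET by rewrite -xE inE.
  have : q \in [set x]%SET by rewrite -xE inE Dpq.
  by rewrite !inE => /eqP -> /eqP ->.
split; first by do 2!apply/forallP=> ?.
  by apply/forallP=> j; apply/forallP=> i; apply/forallP=> i'; apply/implyP/Dlt.
apply/forallP=> k; apply/implyP=> k0.
pose f (p : 'I_l * 'I_n) := D p.1 p.2.
have imE : [set f p | p : 'I_l * 'I_n]%SET = ~: [set ord0]%SET.
  apply/eqP; rewrite eqEcard; apply/andP; split.
    by apply/fintype.subsetP=> _ /imsetP[p _ ->]; rewrite !inE -val_eqE /= -lt0n D0.
  by rewrite card_imset // card_prod !card_ord cardsC1 card_ord.
have : k \in [set f p | p : 'I_l * 'I_n]%SET by rewrite imE !inE -val_eqE /= -lt0n.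
case/imsetP=> p _ kE; apply/cards1P; exists p; apply/setP=> q.
rewrite !inE kE; apply/eqP/eqP => [/Dinj //|->//].
Qed.

(** * Stacking and supermultiplicativity *)

Section Stack.
Variables m n : nat.
Implicit Types (D : collection l m) (E : collection l n).

(** The shift [l * m] bounds all faces of [D]. Here [inord] is only a cast: the next two lemmas
    check that no value overflows. *)
Definition stack D E : collection l (m + n) :=
  [ffun j => [ffun i => inord match fintype.split i with
                              | inl a => D j a
                              | inr b => l * m + E j b
                              end]].

Lemma stack_lshift D E j a : stack D E j (lshift n a) = D j a :> nat.
Proof.
rewrite !ffunE (unsplitK (inl _ a)) inordK //.
by apply: leq_trans (ltn_ord _) _; rewrite ltnS leq_mul2l leq_addr orbT.
Qed.

Lemma stack_rshift D E j b : stack D E j (rshift m b) = l * m + E j b :> nat.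
Proof.
rewrite !ffunE (unsplitK (inr _ b)) inordK //.
by rewrite mulnDr ltnS leq_add2l -ltnS ltn_ord.
Qed.

Lemma stack_dice D E : is_dice_collection D -> is_dice_collection E ->
  is_dice_collection (stack D E).
Proof.
move=> /dice_collectionP[D0 Dlt Dinj] /dice_collectionP[E0 Elt Einj].
have DE j a j' b : D j a < l * m + E j' b.
  by have := ltn_ord (D j a); have := E0 j' b; lia.
apply/dice_collectionP; split=> [j i|j i i'|[j i] [j' i'] /= /(congr1 val)/=].
- by case: (split_ordP i) => k ->; rewrite ?stack_lshift ?stack_rshift ?addn_gt0
    ?D0 ?E0 ?orbT.
- case: (split_ordP i) => k ->; case: (split_ordP i') => k' -> /=;
    rewrite ?stack_lshift ?stack_rshift ?ltn_add2l //.
  + exact: Dlt.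
  + by have := ltn_ord k'; lia.
  + exact: Elt.
- case: (split_ordP i) => k ->; case: (split_ordP i') => k' -> /=;
    rewrite ?stack_lshift ?stack_rshift.
  + by move/val_inj => /(Dinj (j, k) (j', k'))[-> ->].
  + by move=> h; have := DE j k j' k'; rewrite h ltnn.
  + by move=> h; have := DE j' k' j k; rewrite h ltnn.
  + by move/addnI/val_inj => /(Einj (j, k) (j', k'))[-> ->].
Qed.

(** The pairs of faces form four quadrants. In the two mixed ones the face from [E] always wins,
    which gives [m * n] pairs to each die. *)
Lemma stack_better D E j j' : is_dice_collection E ->
  better (D j) (D j') -> better (E j) (E j') ->
  better (stack D E j) (stack D E j').
Proof.
move=> /dice_collectionP[E0 _ _].
have lt1 x a y b : D x a < l * m + E y b.
  by have := ltn_ord (D x a); have := E0 y b; lia.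
have lt2 x a y b : (l * m + E y b < D x a) = false.
  by apply/negbTE; rewrite -leqNgt ltnW.
rewrite !betterE => hD hE.
rewrite !big_split_ord /=.
under [X in X + _ < _]eq_bigr do rewrite big_split_ord /=.
under [X in _ + X < _]eq_bigr do rewrite big_split_ord /=.
under [X in _ < X + _]eq_bigr do rewrite big_split_ord /=.
under [X in _ < _ + X]eq_bigr do rewrite big_split_ord /=.
rewrite !big_split /=.
under eq_bigr do under eq_bigr do rewrite !stack_lshift.
under [X in _ + X + _ < _]eq_bigr do under eq_bigr do
  rewrite stack_lshift stack_rshift lt1.
under [X in _ + (X + _) < _]eq_bigr do under eq_bigr do
  rewrite stack_lshift stack_rshift lt2.
under [X in _ + (_ + X) < _]eq_bigr do under eq_bigr do
  rewrite !stack_rshift ltn_add2l.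
under [X in _ < X + _ + _]eq_bigr do under eq_bigr do rewrite !stack_lshift.
under [X in _ < _ + X + _]eq_bigr do under eq_bigr do
  rewrite stack_lshift stack_rshift lt2.
under [X in _ < _ + (X + _)]eq_bigr do under eq_bigr do
  rewrite stack_lshift stack_rshift lt1.
under [X in _ < _ + (_ + X)]eq_bigr do under eq_bigr do
  rewrite !stack_rshift ltn_add2l.
rewrite !sum_nat_const !card_ord !muln0 !muln1 add0n addn0 (mulnC n).
(* The common term [m * n] cancels; strictness is then kept for [D] and dropped for [E]. *)
rewrite -addnA addnCA [ltnRHS]addnCA ltn_add2l -addSn.
by apply: leq_add => //; exact: ltnW.
Qed.

Lemma stack_inj : injective (fun p => stack p.1 p.2).
Proof.
move=> [D E] [D' E'] /= eqDE; congr pair; apply/ffunP=> j; apply/ffunP=> i;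
  apply: val_inj => /=.
  by rewrite -(stack_lshift D E) eqDE stack_lshift.
by apply: (@addnI (l * m)); rewrite -(stack_rshift D E) eqDE stack_rshift.
Qed.

Lemma card_intransitive_supermul :
  #|intransitive_collections l m| * #|intransitive_collections l n|
    <= #|intransitive_collections l (m + n)|.
Proof.
rewrite -cardsX -(card_imset _ stack_inj); apply: subset_leq_card.
apply/fintype.subsetP=> _ /imsetP[[D E] /= DE ->].
move: DE; rewrite !inE /= => /andP[/andP[dD /forallP bD] /andP[dE /forallP bE]].
by rewrite stack_dice //=; apply/forallP=> j; apply: stack_better.
Qed.

End Stack.

(** Since its faces increase, a die is determined by the set of its faces. This leaves at most
    [2 ^ ((l * n + 1) * l)] collections, and [l <= l * n] as [n] is positive. *)
Lemma card_intransitive_le n : 0 < n ->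
  #|intransitive_collections l n| <= (2 ^ (l * l + l)) ^ n.
Proof.
move=> n0.
pose f (D : collection l n) : {ffun 'I_l -> {set 'I_(l * n).+1}} :=
  [ffun j => [set D j i | i : 'I_n]%SET].
have f_inj : {in dice_collections l n &, injective f}.
  move=> D E; rewrite !inE => /dice_collectionP[_ Dlt _].
  move=> /dice_collectionP[_ Elt _] fDE; apply/ffunP=> j.
  have sorted_faces (F : {ffun 'I_n -> 'I_(l * n).+1}) :
      (forall i i' : 'I_n, i < i' -> F i < F i') ->
      sorted (relpre val ltn) [seq F i | i <- enum 'I_n].
    move=> Flt; rewrite sorted_map; apply: sub_sorted (_ : sorted (relpre val ltn) _).
      by move=> i i' /=; exact: Flt.
    by rewrite -sorted_map val_enum_ord iota_ltn_sorted.
  have eq_faces : [seq D j i | i <- enum 'I_n] = [seq E j i | i <- enum 'I_n].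
    apply: (@irr_sorted_eq _ (relpre val ltn)).
    - by move=> y x z; exact: ltn_trans.
    - by move=> x; exact: ltnn.
    - exact/sorted_faces/Dlt.
    - exact/sorted_faces/Elt.
    move=> k; have : (k \in f D j) = (k \in f E j) by rewrite fDE.
    rewrite !ffunE.
    have memE (F : {ffun 'I_n -> 'I_(l * n).+1}) :
        (k \in [seq F i | i <- enum 'I_n]) = (k \in [set F i | i : 'I_n]%SET).
      apply/mapP/imsetP => [[i _ ->]|[i _ ->]]; first by exists i.
      by exists i; rewrite ?mem_enum.
    by rewrite !memE.
  by move/eq_in_map: eq_faces => DEj; apply/ffunP=> i; apply: DEj; rewrite mem_enum.
apply: leq_trans (_ : #|dice_collections l n| <= _).
  by apply: subset_leq_card; apply/fintype.subsetP=> D; rewrite inE => /andP[].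
rewrite -(card_in_imset f_inj); apply: leq_trans (max_card _) _.
rewrite card_ffun -cardsT -powersetT card_powerset cardsT !card_ord.
rewrite -!expnM leq_exp2l //; nia.
Qed.

(** * Existence by Condorcet rotation *)

Section Rotation.
Variable n : nat.
Hypotheses (l_ge3 : 3 <= l) (n_ge7 : 7 <= n).

(* In block [i] the largest face belongs to die [i %% l]; its predecessor has the
   smallest, and is the only die that loses to its successor in this block. *)
Definition rotation : collection l n :=
  [ffun j : 'I_l => [ffun i : 'I_n => inord (i * l + (i + (l.-1 - j)) %% l).+1]].

Lemma rotationE (j : 'I_l) i :
  rotation j i = (i * l + (i + (l.-1 - j)) %% l).+1 :> nat.
Proof.
rewrite !ffunE inordK // !ltnS.
have : (i + (l.-1 - j)) %% l < l by rewrite ltn_mod; lia.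
by have := ltn_ord i; nia.
Qed.

Lemma rotation_lt (j j' : 'I_l) (i i' : 'I_n) :
  i < i' -> rotation j i < rotation j' i'.
Proof.
have := @ltn_pmod (i + (l.-1 - j)) l; rewrite !rotationE; nia.
Qed.

Lemma rotation_dice : is_dice_collection rotation.
Proof.
apply/dice_collectionP; split=> [j i|j i i'|[j i] [j' i'] /= eqr].
- by rewrite rotationE.
- exact: rotation_lt.
have ii' : i = i'.
  apply: val_inj; case: (ltngtP i i') => // /rotation_lt.
    by move/(_ j j'); rewrite eqr ltnn.
  by move/(_ j' j); rewrite eqr ltnn.
move: eqr; rewrite ii' => /(congr1 val) /=; rewrite !rotationE => -[].
move/addnI/eqP; rewrite eqn_modDl.
rewrite !modn_small; try lia.
move=> /eqP jj'; congr pair; apply: val_inj => /=.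
by have := ltn_ord j; have := ltn_ord j'; lia.
Qed.

(** Within block [i], the offset of die [j] is that of its successor plus one modulo [l]; it is
    larger unless it wraps around to zero. *)
Lemma rotation_ordS (j : 'I_l) (i : 'I_n) : i %% l != ordS j ->
  rotation (ordS j) i < rotation j i.
Proof.
have sl := ltn_ord (ordS j); rewrite !rotationE ltnS ltn_add2l => ij.
set x := i + (l.-1 - ordS j).
have -> : (i + (l.-1 - j)) %% l = x.+1 %% l.
  have [jl|jl] := ltnP j.+1 l; rewrite /x /= ?(modn_small jl).
    by congr (_ %% _); lia.
  have -> : j.+1 = l by have := ltn_ord j; lia.
  rewrite modnn subn0 -addnS prednK; last lia.
  by rewrite modnDr; congr (_ %% _); lia.
rewrite modnS; case: ifP => // /dvdnP[k xE]; case/eqP: ij.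
have -> : i %% l = (k * l + ordS j) %% l.
  by rewrite -xE -(modnDr i); congr (_ %% _); rewrite /x; lia.
by rewrite modnMDl modn_small.
Qed.

(** A residue class has at most [n %/ l + 1 <= n %/ 3 + 1] elements, which is below half of [n] once
    [n >= 7]. *)
Lemma card_mod_lt c : 2 * #|[set i : 'I_n | i %% l == c]%SET| < n.
Proof.
set A := [set _ | _]%SET.
pose f (i : 'I_n) : 'I_(n %/ l).+1 := inord (i %/ l).
have f_inj : {in A &, injective f}.
  move=> i i'; rewrite !inE => /eqP ic /eqP i'c /(congr1 val) /=.
  rewrite !inordK ?ltnS ?leq_div2r // 1?ltnW // => eqd.
  by apply: val_inj; rewrite /= (divn_eq i l) (divn_eq i' l) eqd ic i'c.
have := max_card (mem (f @: A)); rewrite card_in_imset // card_ord.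
have : n %/ l <= n %/ 3 by apply: leq_div2l.
lia.
Qed.

(** Faces in different blocks compare as their blocks do, so these pairs split evenly. The diagonal
    pairs decide, and die [j] can lose only those with index in [S], a minority. *)
Lemma rotation_better (j : 'I_l) : better (rotation j) (rotation (ordS j)).
Proof.
rewrite betterE; set c := nat_of_ord (ordS j).
set S := [set i : 'I_n | i %% l == c]%SET.
have lossE (i k : 'I_n) : (rotation j i < rotation (ordS j) k)%N
    <= (i < k) + (if k == i then (i \in S : nat) else 0).
  case: eqP => [->|/eqP ki]; last first.
    case: (ltngtP i k) => [_|lt_ki|/val_inj ik]; last by rewrite ik eqxx in ki.
      by rewrite addn0 leq_b1.
    by rewrite ltnNge (ltnW (rotation_lt _ _ _ _ lt_ki)).
  rewrite ltnn add0n inE; case: (boolP (i %% l == c)) => [_|/rotation_ordS lt].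
    by rewrite leq_b1.
  by rewrite ltnNge (ltnW lt).
have winE (i k : 'I_n) : (k < i) + (if k == i then (i \notin S : nat) else 0)
    <= (rotation (ordS j) k < rotation j i)%N.
  case: eqP => [->|/eqP ki]; last first.
    by rewrite addn0; case: (ltnP k i) => // /rotation_lt ->.
  by rewrite ltnn add0n inE; case: (boolP (i %% l == c)) => // /rotation_ordS ->.
have diagE (b : 'I_n -> bool) :
    \sum_i \sum_k (if k == i then (b i : nat) else 0) = \sum_i b i.
  by apply: eq_bigr => i _; rewrite -big_mkcond big_pred1_eq.
have sumS : \sum_i (i \in S) = #|S| by rewrite -sum1_card [RHS]big_mkcond.
have sumSC : \sum_i (i \notin S) = #|~: S|%SET.
  rewrite -sum1_card [RHS]big_mkcond; apply: eq_bigr => i _.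
  by rewrite finset.in_setC; case: (i \in S).
apply: leq_ltn_trans (_ : \sum_(i < n) \sum_(k < n) (i < k) + #|S| < _).
  rewrite -sumS -diagE -big_split /=; apply: leq_sum => i _.
  by rewrite -big_split /=; apply: leq_sum => k _; exact: lossE.
apply: leq_trans (_ : _ < \sum_(i < n) \sum_(k < n) (k < i) + #|~: S|%SET) _.
  (* Swapping the summations identifies the off-diagonal counts and leaves [#|S| < #|~: S|]. *)
  rewrite exchange_big ltn_add2l.
  by have := cardsC S; have := card_mod_lt c; rewrite -/S card_ord; lia.
rewrite -sumSC -diagE -big_split /=; apply: leq_sum => i _.
by rewrite -big_split /=; apply: leq_sum => k _; exact: winE.
Qed.

Lemma intransitive_gt0 : 0 < #|intransitive_collections l n|.
Proof.
apply/card_gt0P; exists rotation; rewrite !inE rotation_dice /=.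
by apply/forallP=> j; exact: rotation_better.
Qed.

End Rotation.
End Collections.

(** * The exponential growth rate *)

Local Open Scope ring_scope.

Theorem theorem2 (R : realType) (l : nat) (hl : (3 <= l)%N) :
  exists L : R, 0 <= L /\
    exists r : nat -> R,
      r =o_\oo (fun n : nat => n%:R : R) /\
      \forall n \near \oo,
        (#|intransitive_collections l n|)%:R = expR (n%:R * L + r n).
Proof.
pose a n : R := (#|intransitive_collections l n|)%:R.
have a_ge1 n : (7 <= n)%N -> 1 <= a n.
  by move=> n7; rewrite ler1n intransitive_gt0.
have a_gt0 n : (7 <= n)%N -> 0 < a n by move/a_ge1; exact: lt_le_trans.
(* The threshold 7 is where [intransitive_gt0] starts to apply, making the logarithms
   nonnegative. *)
have [|m n m7 n7||L [L0 Lo]] :=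
    @fekete R (fun n => ln (a n)) 7 (ln (2 ^ (l * l + l))%:R) isT.
- by move=> n n7; rewrite ln_ge0 ?a_ge1.
- rewrite -lnM ?posrE ?a_gt0 // ler_ln ?posrE ?mulr_gt0 ?a_gt0 //; last lia.
  by rewrite -natrM ler_nat card_intransitive_supermul.
- move=> n n7; rewrite mulrC mulr_natr -lnXn ?ltr0n ?expn_gt0 //.
  rewrite ler_ln ?posrE ?a_gt0 ?exprn_gt0 ?ltr0n ?expn_gt0 //.
  by rewrite -natrX ler_nat card_intransitive_le //; lia.
(* With this remainder the exponential formula is exact wherever [a n] is positive. *)
exists L; split=> //; exists (fun n => ln (a n) - n%:R * L); split=> //.
near=> n.
by rewrite addrC subrK lnK // posrE a_gt0 //; near: n; exists 7%N.
Unshelve. all: by end_near. Qed.
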